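(* Let $\Omega\subseteq\mathbb{T}$ be measurable, with positive finite measure $T=|\Omega|_{\mathbb{T}}$ and essential arc diameter $D=D_{\mathbb{T}}(\Omega)$, and let $P(z)=\sum_{k=0}^n a_kz^k\in\mathbb{C}[z]$ be a polynomial of degree $n\ge 1$. Assume $nD\le 2\pi$. Define $Q(z)=\sum_{k=0}^n|a_k|z^k$. Then $$\int_\Omega|P(z)|^2\,\mathrm{dm}(z)\le\int_{I_T}|Q(z)|^2\,\mathrm{dm}(z).$$ Moreover, $\|P\|_{L^2(\mathbb{T})}=\|Q\|_{L^2(\mathbb{T})}$, and hence $$c_\Omega(P)\le c_{I_T}(Q).$$
   Context: $\mathbb{T}=\{z\in\mathbb{C}:|z|=1\}$ is the unit circle, and $\mathrm{dm}$ is arc-length measure on $\mathbb{T}$, normalized so that $\int_{\mathbb{T}}\mathrm{dm}=2\pi$; $|\Omega|_{\mathbb{T}}=\int_\Omega\mathrm{dm}(z)$. The $L^2(\mathbb{T})$ norm is taken with respect to $\mathrm{dm}$. For $0<T\le2\pi$, $I_T=\{e^{i\theta}:-T/2\le\theta\le T/2\}$ is the centered arc of measure $T$. The essential arc diameter is $D_{\mathbb{T}}(\Omega)=\inf\{D\in[0,2\pi]:\Omega\text{ is contained, up to a null set, in a circular arc of length }D\}$. For measurable $\Omega\subseteq\mathbb{T}$ and a nonzero polynomial $P$, the concentration is $c_\Omega(P)=\int_\Omega|P(z)|^2\,\mathrm{dm}(z)\big/\int_{\mathbb{T}}|P(z)|^2\,\mathrm{dm}(z)$. *)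

(* Defs.v *)
From HB Require Import structures.
From mathcomp Require Import all_boot all_order all_algebra.
From mathcomp Require Import all_classical all_reals all_analysis.
From mathcomp Require Import complex.

Set Implicit Arguments.
Unset Strict Implicit.
Unset Printing Implicit Defensive.

Import Order.TTheory GRing.Theory Num.Theory.
Import numFieldNormedType.Exports.

Local Open Scope classical_set_scope.
Local Open Scope ring_scope.
Local Open Scope complex_scope.

Definition circle (R : realType) := {z : R[i] | `|z| == 1}.

HB.instance Definition _ (R : realType) := Choice.on (circle R).

Lemma norm_cis (R : realType) (t : R) : `|cos t +i* sin t| == 1.
Proof. by rewrite normc_def /= cos2Dsin2 sqrtr1. Qed.

(* cis t = e^{i t} *)
Definition cis (R : realType) (t : R) : circle R :=
  exist _ (cos t +i* sin t) (norm_cis t).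

HB.instance Definition _ (R : realType) := isPointed.Build (circle R) (cis 0).

(* The real line with the Lebesgue (Caratheodory) sigma-algebra, which is the
   domain of completed_lebesgue_measure; the default sigma-algebra on R in the
   library is the Borel one. *)
Notation lebesgue_type R := (caratheodory_type (@wlength R idfun)^*%mu).

(* As cis is periodic, this is the sigma-algebra of all Lebesgue measurable
   subsets of the circle. *)
Definition circle_measurable (R : realType) : set (set (circle R)) :=
  image_set_system setT (@cis R) (measurable : set (set (lebesgue_type R))).
Arguments circle_measurable : clear implicits.

Section circle_measurableType.
Variable R : realType.

Lemma sigma_algebra_circle : sigma_algebra setT (circle_measurable R).
Proof. exact/sigma_algebra_image/sigma_algebra_measurable. Qed.

Let circle_measurable0 : circle_measurable R set0.
Proof. by have [] := sigma_algebra_circle. Qed.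

Let circle_measurableC A :
  circle_measurable R A -> circle_measurable R (~` A).
Proof. by have [_ + _] := sigma_algebra_circle => /[apply]; rewrite setTD. Qed.

Let circle_measurable_bigcup (F : (set (circle R))^nat) :
  (forall i, circle_measurable R (F i)) ->
  circle_measurable R (\bigcup_i F i).
Proof. by have [_ _] := sigma_algebra_circle; apply. Qed.

HB.instance Definition _ := @isMeasurable.Build default_measure_display
  (circle R) (circle_measurable R)
  circle_measurable0 circle_measurableC circle_measurable_bigcup.

Lemma measurable_cis :
  measurable_fun setT (@cis R : lebesgue_type R -> circle R).
Proof. by move=> _ A. Qed.

Lemma measurable_period :
  measurable (`]- pi, pi] : set (lebesgue_type R)).
Proof. by apply: sub_caratheodory; exact: measurable_itv. Qed.

(* Arc length (total mass 2 pi): the image under t |-> e^{i t} of Lebesgue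
   measure on one period. *)
Definition dm (A : set (circle R)) : \bar R :=
  completed_lebesgue_measure (`]- pi, pi] `&` @cis R @^-1` A).

Let dm0 : dm set0 = 0%E.
Proof. by rewrite /dm preimage_set0 setI0 measure0. Qed.

Let dm_ge0 A : (0 <= dm A)%E.
Proof. exact: measure_ge0. Qed.

Let measurable_period_cis (A : set (circle R)) : measurable A ->
  measurable (`]- pi, pi] `&` @cis R @^-1` A : set (lebesgue_type R)).
Proof.
move=> mA; apply: measurableI; first exact: measurable_period.
by rewrite -[_ @^-1` _]setTI; exact: measurable_cis.
Qed.

Let dm_sigma_additive : semi_sigma_additive dm.
Proof.
move=> F mF tF mUF; rewrite /dm preimage_bigcup setI_bigcupr.
apply: measure_semi_sigma_additive.
- by move=> i; exact: measurable_period_cis.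
- apply/trivIsetP => /= i j _ _ ij; rewrite -subset0.
  move=> t [[_ Fit] [_ Fjt]]; have /trivIsetP/(_ i j I I ij) Fij := tF.
  by have : (F i `&` F j) (cis t) by []; rewrite Fij.
- by rewrite -setI_bigcupr -preimage_bigcup; exact: measurable_period_cis.
Qed.

HB.instance Definition _ := isMeasure.Build default_measure_display
  (circle R) R dm dm0 dm_ge0 dm_sigma_additive.

Lemma dmT : dm setT = (2 * pi)%:E.
Proof.
rewrite /dm preimage_setT setIT.
rewrite [LHS](_ : _ = lebesgue_measure `]- pi, (pi : R)]) //.
by rewrite lebesgue_measure_itv /= lte_fin gtrN ?pi_gt0 // opprK mulr_natl.
Qed.

End circle_measurableType.
Arguments dm {R}.

Section concentration.
Variable R : realType.
Implicit Types (Omega : set (circle R)) (P : {poly R[i]}).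

(* The closed arc from e^{ia} to e^{ib}, of length b - a if 0 <= b - a <= 2 pi. *)
Definition arc (a b : R) : set (circle R) := @cis R @` `[a, b].

Definition centered_arc (T : R) : set (circle R) := arc (- (T / 2)) (T / 2).

Definition essential_arc_diameter Omega : R :=
  inf [set D | 0 <= D <= 2 * pi /\
               exists a, dm.-negligible (Omega `\` arc a (a + D))].

(* |P(z)|; normc is the modulus as an element of R, whereas `|_| on
   R[i] takes its values in R[i]. *)
Definition modulus P (z : circle R) : R := ComplexField.Normc.normc P.[val z].

Definition L2norm P : \bar R := Lnorm dm 2%:E (EFin \o modulus P).

Definition concentration Omega P : R :=
  (\int[dm]_(z in Omega) (modulus P z ^+ 2)) /
  (\int[dm]_(z in setT) (modulus P z ^+ 2)).

End concentration.

(* Main.v *)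
Require Import Defs.
From HB Require Import structures.
From mathcomp Require Import all_boot all_order all_algebra.
From mathcomp Require Import all_classical all_reals all_analysis.
From mathcomp Require Import complex measurable_realfun zify lra ring.

(** Write a_k = r_k e^{i b_k}. Expanding the square,
    |P(e^{it})|^2 = \sum_{j,k} r_j r_k cos((j - k) t + (b_j - b_k)),
    and |Q(e^{it})|^2 is the same double sum with all the phases b_k erased.
    As r_j r_k >= 0, the local inequality follows, term by term, from the
    following statement on a single frequency m with |m| <= n
    ([integral_wave_le]): for every phase al,
    \int_Omega cos(m t + al) <= \int_{-T/2}^{T/2} cos(m t).

    For m = 0 both sides are compared with the common measure T. The frequencies
    m and - m are exchanged by al |-> - al. For m > 0 this is a bathtub argument.
    Put c = cos(m T / 2) and let g = cos(m t + al) - c. Since Omega and [-T/2, T/2] have the same measure, c may be subtracted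
    from the cosines on both sides. Up to a null set Omega lies in an arc of
    length D', for some D' as close as desired to the essential diameter D, so
    that \int_Omega g is at most the integral of the positive part g^+ on that
    arc ([integral_le_arc]). The hypothesis m D <= n D <= 2 pi says that an arc
    of length D fits into one period 2 pi / m of g^+, and the integral of g^+
    over a period depends neither on the phase nor on the starting point
    ([ge0_integral_period]): it is the integral over [-pi/m, pi/m] of
    (cos(m t) - c)^+, which vanishes off [-T/2, T/2] because
    T <= D <= 2 pi / m ([integral_excess_period]). The excess of D' over D
    costs at most 2 (D' - D), which tends to 0.

    Equality of the L^2 norms is Parseval, in the form that the integral of
    cos(m t + al) over the whole circle does not depend on al when m <> 0
    ([integral_wave_full]), whereas the terms with m = j - k = 0 have no phase.
    The comparison of the concentrations is the quotient of the two results.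

    Integrals over the circle are brought back to the real line, where Borel
    functions and translations are available, by [integral_arc]. *)

Set Implicit Arguments.
Unset Strict Implicit.
Unset Printing Implicit Defensive.

Import Order.TTheory GRing.Theory Num.Theory.
Import numFieldNormedType.Exports.

Local Open Scope classical_set_scope.
Local Open Scope ring_scope.
Local Open Scope complex_scope.

(* Arcs of the circle, not of cyclic sequences. *)
Local Notation arc := Defs.arc.
Local Notation normc := ComplexField.Normc.normc.

(** * Translations and periods of Lebesgue integrals *)

Section translation.
Context {R : realType}.
Notation lambda := (@lebesgue_measure R).

Lemma mod_period (u p : R) : 0 < p ->
  exists k : int, 0 <= u - p * k%:~R < p.
Proof.
move=> p0; exists (Num.floor (u / p)).
have := floorD1_gt (u / p); have := ge_floor (u / p).
rewrite ler_pdivlMr // ltr_pdivrMr // intrD mulrDl mul1r => kl ku.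
by rewrite mulrC subr_ge0 kl ltrBlDr addrC.
Qed.

Lemma lebesgue_measureD (s : R) (A : set R) : measurable A ->
  pushforward lambda (fun t : R => t + s : measurableTypeR R) A = lambda A.
Proof.
move=> mA.
have ms : measurable_fun setT
    (fun t : measurableTypeR R => t + s : measurableTypeR R).
  by apply: measurable_funD => //; exact: measurable_id.
pose sh : {mfun measurableTypeR R >-> measurableTypeR R} :=
  HB.pack (fun t : measurableTypeR R => t + s : measurableTypeR R)
    (isMeasurableFun.Build _ _ _ _ _ ms).
apply/esym/(@lebesgue_measure_unique _ (pushforward lambda sh)) => //=.
move=> _ [[a b]] _ <-; rewrite /pushforward.
have -> : sh @^-1` `]a, b] = `]a - s, b - s]%classic.
  by apply/seteqP; split => t /=; rewrite !in_itv /= ltrBlDr lerBrDr.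
rewrite !lebesgue_measure_itv/= !lte_fin ltrD2r; case: ifP => // _.
by rewrite -!EFinD opprB addrA subrK.
Qed.

Lemma ge0_integral_shift (f : R -> R) (s x y : R) :
  measurable_fun setT f -> (forall t, 0 <= f t) ->
  (\int[lambda]_(t in `]x, y]) (f (t + s))%:E =
   \int[lambda]_(t in `](x + s)%R, (y + s)%R]) (f t)%:E)%E.
Proof.
move=> mf f0.
have ms : measurable_fun setT
    (fun t : measurableTypeR R => t + s : measurableTypeR R).
  by apply: measurable_funD => //; exact: measurable_id.
have -> : `]x, y]%classic =
    (fun t : R => t + s : measurableTypeR R) @^-1` `]x + s, y + s].
  by apply/seteqP; split => t /=; rewrite !in_itv /= ltrD2r lerD2r.
rewrite -[LHS](@ge0_integral_pushforward _ _ _ _ _ _ ms lambda _ (EFin \o f)) //=.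
- by apply: eq_measure_integral => A mA _; exact: lebesgue_measureD.
- by apply/measurable_EFinP; exact: measurable_funS mf.
- by move=> t _; rewrite lee_fin.
Qed.

Lemma ge0_integral_itvU (f : R -> R) (x y z : R) :
  measurable_fun setT f -> (forall t, 0 <= f t) -> x <= y -> y <= z ->
  (\int[lambda]_(t in `]x, z]) (f t)%:E =
   \int[lambda]_(t in `]x, y]) (f t)%:E + \int[lambda]_(t in `]y, z]) (f t)%:E)%E.
Proof.
move=> mf f0 xy yz.
rewrite -ge0_integral_setU //=.
- by rewrite -itv_bndbnd_setU // bnd_simp.
- by apply/measurable_EFinP; exact: measurable_funS mf.
- by move=> t _; rewrite lee_fin.
- apply/disj_setPS => t /= []; rewrite !in_itv /= => /andP[_ ty] /andP[yt _].
  by move: (lt_le_trans yt ty); rewrite ltxx.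
Qed.

(** Translating the window by L leaves the integral unchanged, which allows s to
    be taken in [0, L[; the part of the window beyond L is then translated back
    to ]0, s]. *)
Lemma ge0_integral_period (f : R -> R) (L s s' : R) :
  0 < L -> measurable_fun setT f -> (forall t, 0 <= f t) -> periodic f L ->
  (\int[lambda]_(t in `]s, (s + L)%R]) (f t)%:E =
   \int[lambda]_(t in `]s', (s' + L)%R]) (f t)%:E)%E.
Proof.
move=> L0 mf f0 fL.
pose F (u : R) : \bar R := (\int[lambda]_(t in `]u, (u + L)%R]) (f t)%:E)%E.
have FD (k : nat) u : F (u + L *+ k) = F u.
  rewrite /F addrAC -ge0_integral_shift //.
  by apply: eq_integral => t _; rewrite periodicn.
have FZ (k : int) u : F (u + L *~ k) = F u.
  case: k => k; first by rewrite -pmulrn FD.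
  by rewrite NegzE mulrNz -[in RHS](subrK (L *~ k.+1) u) -[in RHS]pmulrn FD.
have F0 u : 0 <= u < L -> F u = F 0.
  move=> /andP[u0 uL]; rewrite /F add0r.
  rewrite (@ge0_integral_itvU _ u L) ?(ltW uL) ?lerDr //.
  rewrite [RHS](@ge0_integral_itvU _ 0 u) ?(ltW uL) // addeC; congr (_ + _)%E.
  rewrite -[X in `]X, _]]add0r -ge0_integral_shift //.
  by apply: eq_integral => t _; rewrite fL.
have FE u : F u = F 0.
  have [k uk] := mod_period u L0.
  by rewrite -[u](subrK (L *~ k)) FZ F0 // -mulrzr.
by rewrite -/(F s) -/(F s') FE [RHS]FE.
Qed.

End translation.

(** * The parametrization of the circle *)

Section circle_geometry.
Context {R : realType}.
Implicit Types (s t a b : R) (z : circle R).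

Lemma cos_intpi t (k : int) : cos (t + 2 * pi * k%:~R) = cos t.
Proof.
have H (n : nat) (u : R) : cos (u + 2 * pi * n%:R) = cos u.
  by rewrite mulr_natr mulr_natl; exact: (periodicn (@cosD2pi R)).
case: k => n; first exact: H.
by rewrite NegzE intrN mulrN -[in RHS](subrK (2 * pi * n.+1%:R) t) H.
Qed.

Lemma sin_intpi t (k : int) : sin (t + 2 * pi * k%:~R) = sin t.
Proof. by rewrite -!cosBpihalf addrAC cos_intpi. Qed.

Lemma cis_intpi t (k : int) : cis (t + 2 * pi * k%:~R) = cis t.
Proof. by apply: val_inj; rewrite /= cos_intpi sin_intpi. Qed.

(** Halving the angle turns cos x = 1 into sin (x / 2) = 0, and sin is positive
    on ]0, pi[. *)
Lemma cos_eq1 (x : R) : 0 <= x < 2 * pi -> cos x = 1 -> x = 0.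
Proof.
move=> /andP[x0 x2]; have [->//|xn0] := eqVneq x 0.
have : 0 < sin (x / 2).
  apply: sin_gt0_pi; rewrite ltr_pdivrMr // [pi * 2]mulrC x2 andbT.
  by rewrite divr_gt0 // lt_def xn0.
rewrite {2}(_ : x = (x / 2) *+ 2); last by rewrite -mulr_natr divfK.
move=> s0; rewrite cos_mulr2n cos2sin2 => H.
have : sin (x / 2) ^+ 2 = 0 by move: H; rewrite mulr2n; lra.
by move/eqP; rewrite sqrf_eq0 gt_eqF.
Qed.

Lemma cis_eq s t : cis s = cis t -> exists k : int, s = t + 2 * pi * k%:~R.
Proof.
move=> /(congr1 val) /= [cst sst].
have c1 : cos (s - t) = 1 by rewrite cosB cst sst -!expr2 cos2Dsin2.
have p0 : 0 < 2 * pi :> R by rewrite mulr_gt0 // pi_gt0.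
have [k kl] := mod_period (s - t) p0; exists k.
have : cos (s - t - 2 * pi * k%:~R) = 1 by rewrite -mulrN -intrN cos_intpi.
move/cos_eq1 => /(_ kl) /eqP.
by rewrite subr_eq0 => /eqP <-; rewrite subrKC.
Qed.

(** The angle is acos (x / r), up to a sign, which is that of the imaginary
    part. *)
Lemma polarP (w : R[i]) : exists b : R,
  w = (normc w * cos b) +i* (normc w * sin b).
Proof.
case: w => x y /=; set r := Num.sqrt _.
have r0 : 0 <= r by exact: sqrtr_ge0.
have r2 : r ^+ 2 = x ^+ 2 + y ^+ 2 by rewrite sqr_sqrtr // addr_ge0 ?sqr_ge0.
have [rz|rn0] := eqVneq r 0.
  move: r2; rewrite rz expr0n /= => /esym/eqP.
  rewrite paddr_eq0 ?sqr_ge0 // !sqrf_eq0 => /andP[/eqP -> /eqP ->].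
  by exists 0; rewrite !mul0r.
have rp : 0 < r by rewrite lt_def rn0.
have xr : -1 <= x / r <= 1.
  rewrite -ler_norml normrM normfV (gtr0_norm rp) ler_pdivrMr // mul1r.
  rewrite -(ger0_norm r0) -ler_sqr ?nnegrE // !real_normK ?num_real //.
  by rewrite r2 lerDl sqr_ge0.
have ss : r * sin (acos (x / r)) = `|y|.
  rewrite sin_acos // -sqrtr_sqr.
  have -> : y ^+ 2 = r ^+ 2 * (1 - (x / r) ^+ 2).
    by rewrite mulrBr mulr1 expr_div_n mulrCA divff ?sqrf_eq0 //
      mulr1 r2 addrC addKr.
  by rewrite sqrtrM ?sqr_ge0 // sqrtr_sqr ger0_norm.
have cc : r * cos (acos (x / r)) = x by rewrite acosK ?in_itv //= mulrC divfK.
have [y0|y0] := leP 0 y.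
  by exists (acos (x / r)); rewrite ss cc ger0_norm.
by exists (- acos (x / r)); rewrite cosN sinN mulrN ss cc ltr0_norm // opprK.
Qed.

Lemma cis_surj z : exists t, cis t = z.
Proof.
case: z => w w1; have [b wb] := polarP w; exists b; apply: val_inj => /=.
rewrite [RHS]wb; have -> : normc w = 1.
  by case: w w1 {wb} => x y; rewrite normc_def => /eqP [].
by rewrite !mul1r.
Qed.

(** Some argument, without any normalization: functions on the circle are given
    below by 2 pi-periodic functions of it, for which the choice does not
    matter. *)
Definition arg z : R := sval (cid (cis_surj z)).

Lemma argK : cancel arg (@cis R).
Proof. by move=> z; rewrite /arg; case: cid. Qed.

Lemma arg_cis t : exists k : int, arg (cis t) = t + 2 * pi * k%:~R.
Proof. exact/cis_eq/argK. Qed.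

(** The right end a + 2 pi appears because it represents the same point as the
    left end a of the arc, which the half-open window misses. *)
Lemma cis_arc a (D : R) t : D <= 2 * pi -> a < t <= a + 2 * pi ->
  arc a (a + D) (cis t) -> t <= a + D \/ t = a + 2 * pi.
Proof.
move=> D2 /andP[at_ ta] [x /=]; rewrite in_itv /= => /andP[ax xb] /esym/cis_eq[k tx].
have p0 : 0 < 2 * pi :> R by rewrite mulr_gt0 // pi_gt0.
have [k0|k0|k0] := ltgtP k 0.
- have : k%:~R <= -1 :> R by rewrite (ler_int _ _ (-1)); move: k0; lia.
  nra.
- have : 1 <= k%:~R :> R by rewrite ler1z.
  by right; nra.
- by left; rewrite tx k0 mulr0 addr0.
Qed.

Lemma preimage_arc a b :
  @cis R @^-1` arc a b =
    \bigcup_(k : int) `[a + 2 * pi * k%:~R, b + 2 * pi * k%:~R]%classic.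
Proof.
apply/seteqP; split => t /=.
  move=> [x /=]; rewrite in_itv /= => /andP[ax xb] /esym/cis_eq[k ->].
  by exists k => //=; rewrite in_itv /= !lerD2r ax.
move=> [k _] /=; rewrite in_itv /= => /andP[ak kb].
exists (t - 2 * pi * k%:~R); first by rewrite /= in_itv /= lerBrDr ak lerBlDr.
by rewrite -[in RHS](subrK (2 * pi * k%:~R) t) cis_intpi.
Qed.

Lemma measurable_preimage_arc a b :
  measurable (@cis R @^-1` arc a b : set (measurableTypeR R)).
Proof.
by rewrite preimage_arc; apply: countable_bigcupT_measurable => // k.
Qed.

End circle_geometry.

(** * Integration over the circle *)

Section circle_integral.
Context {R : realType}.
Notation lambda := (@lebesgue_measure R).
Notation mu := (@completed_lebesgue_measure R).
Notation period := (`]- pi, pi]%classic : set R).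

Lemma borel_lebesgue_measurable d (Y : measurableType d) (f : R -> Y) :
  measurable_fun setT (f : measurableTypeR R -> Y) ->
  measurable_fun setT (f : lebesgue_type R -> Y).
Proof.
move=> mf _ B mB; rewrite setTI; apply: sub_caratheodory.
by rewrite -[_ @^-1` _]setTI; exact: mf.
Qed.

Lemma measurable_circle_set (A : set (circle R)) :
  measurable (@cis R @^-1` A : set (measurableTypeR R)) -> measurable A.
Proof.
move=> mA; rewrite /measurable /= /circle_measurable /image_set_system /= setTI.
exact: sub_caratheodory.
Qed.

(** Borel measurability along the parametrization suffices, as Borel sets are
    Lebesgue measurable. *)
Lemma measurable_circle_fun d (Y : measurableType d) (F : circle R -> Y) :
  measurable_fun setT (F \o @cis R : measurableTypeR R -> Y) ->
  measurable_fun setT F.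
Proof.
move=> mF _ B mB; rewrite setTI; apply: measurable_circle_set.
by rewrite -[_ @^-1` _]setTI; exact: mF.
Qed.

Lemma measurable_arc a b : measurable (arc a b : set (circle R)).
Proof.
by apply: measurable_circle_set; have := measurable_preimage_arc a b.
Qed.

(** The identity from the Lebesgue to the Borel sigma-algebra is measurable and
    pushes the completed measure forward to the Borel one. *)
Lemma integral_completed (A : set R) (f : R -> R) :
  measurable A -> measurable_fun setT f -> (forall t, 0 <= f t) ->
  (\int[mu]_(t in A) (f t)%:E = \int[lambda]_(t in A) (f t)%:E)%E.
Proof.
move=> mA mf f0.
have mid : measurable_fun setT (id : lebesgue_type R -> measurableTypeR R).
  by apply: borel_lebesgue_measurable; exact: measurable_id.
rewrite -[LHS](@ge0_integral_pushforward _ _ _ _ _ _ mid mu A (EFin \o f)) //=.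
- by apply/measurable_EFinP; exact: measurable_funS mf.
- by move=> t _; rewrite lee_fin.
Qed.

(** By definition dm is the image under cis of the completed measure restricted
    to one period. *)
Lemma integral_dm (A : set (circle R)) (F : circle R -> R) :
  measurable A -> measurable_fun setT F ->
  (forall z, 0 <= F z) ->
  (\int[dm]_(z in A) (F z)%:E =
   \int[mu]_(t in period `&` @cis R @^-1` A) (F (cis t))%:E)%E.
Proof.
move=> mA mF F0.
have mc : measurable_fun setT (@cis R : lebesgue_type R -> circle R).
  exact: measurable_cis.
have mp : measurable (period : set (lebesgue_type R)) by exact: measurable_period.
have mcA : measurable (@cis R @^-1` A : set (lebesgue_type R)).
  by rewrite -[_ @^-1` _]setTI; exact: mc.
pose m := mrestr mu mp.
transitivity (\int[pushforward m (@cis R : lebesgue_type R -> circle R)]_(z in A)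
    (F z)%:E)%E.
  apply: eq_measure_integral => B mB BA.
  by rewrite [RHS]/= /pushforward /= /m /mrestr [X in mu X]setIC.
rewrite [LHS](@ge0_integral_pushforward _ _ _ _ _ _ mc m A (EFin \o F)) //=;
  last 2 first.
- by apply/measurable_EFinP; exact: measurable_funS mF.
- by move=> z _; rewrite lee_fin.
have mFc : measurable_fun setT ((F \o @cis R) : lebesgue_type R -> R).
  exact: measurableT_comp.
(* The restricted measure m does not charge the complement of the period. *)
rewrite (@ge0_negligible_integral _ _ _ m _ (~` period)) //.
- rewrite setDE setCK setIC.
  by apply: eq_measure_integral => B mB BA; rewrite /= /m /mrestr setIidl // => x /BA[].
- exact: measurableC.
- by apply/measurable_EFinP; exact: measurable_funS mFc.
- by move=> t _; rewrite lee_fin.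
- have H : mu (~` period `&` period) = 0%E by rewrite setICl measure0.
  exact: H.
Qed.

Lemma integral_dm_borel (A : set (circle R)) (F : circle R -> R) :
  measurable (@cis R @^-1` A : set (measurableTypeR R)) ->
  measurable_fun setT (F \o @cis R : measurableTypeR R -> R) ->
  (forall z, 0 <= F z) ->
  (\int[dm]_(z in A) (F z)%:E =
   \int[lambda]_(t in period `&` @cis R @^-1` A) (F (cis t))%:E)%E.
Proof.
move=> mA mF F0; rewrite integral_dm //; last 2 first.
- exact: measurable_circle_set.
- exact: measurable_circle_fun.
rewrite (@integral_completed _ (F \o @cis R)) //.
- exact: measurableI.
- by move=> t; exact: F0.
Qed.

(** The function t |-> F (cis t) multiplied by the indicator of the arc has
    period 2 pi, so the fixed window ]-pi, pi] of the definition of dm can be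
    replaced by ]a, a + 2 pi], in which the arc is, up to the point a + 2 pi, a
    single interval. *)
Lemma integral_arc (a D : R) (F : circle R -> R) : 0 <= D <= 2 * pi ->
  measurable_fun setT (F \o @cis R : measurableTypeR R -> R) ->
  (forall z, 0 <= F z) ->
  (\int[dm]_(z in arc a (a + D)) (F z)%:E =
   \int[lambda]_(t in `]a, (a + D)%R]) (F (cis t))%:E)%E.
Proof.
move=> /andP[D0 D2] mF F0; have mA := measurable_preimage_arc a (a + D).
rewrite integral_dm_borel //.
set C : set R := @cis R @^-1` _ in mA *.
pose f (t : R) : R := F (cis t) * \1_C t.
have f0 t : 0 <= f t by rewrite mulr_ge0.
have mf : measurable_fun setT f by apply: measurable_funM.
have fp : periodic f (2 * pi).
  have cisp t : cis (t + 2 * pi) = cis t :> circle R.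
    by have := cis_intpi t 1; rewrite mulr1.
  by move=> t; rewrite /f cisp !indicE; congr (_ * (_ : bool)%:R);
     apply/idP/idP; rewrite /C !inE /= cisp.
have fE (B : set R) : measurable B ->
    (\int[lambda]_(t in B `&` C) (F (cis t))%:E = \int[lambda]_(t in B) (f t)%:E)%E.
  move=> mB; rewrite integral_mkcondr; apply: eq_integral => t _.
  by rewrite patchE /f indicE; case: ifP => _; rewrite ?mulr1 ?mulr0.
have p0 : 0 < 2 * pi :> R by rewrite mulr_gt0 // pi_gt0.
rewrite fE // [X in `]_, X]](_ : pi = - pi + 2 * pi); last by ring.
rewrite (@ge0_integral_period _ f _ _ a p0) //.
rewrite (@ge0_integral_itvU _ f a (a + D)) ?lerDl ?lerD2l //.
rewrite -!fE // [X in (_ + X)%E](_ : _ = 0%E) ?adde0.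
  congr (integral _ _ _); apply/setIidl => t; rewrite /= in_itv /= => /andP[at_ tb].
  by exists t => //=; rewrite in_itv /= ltW.
apply: (@integral_Sset1 _ _ _ (a + 2 * pi)) => t [] /=.
rewrite in_itv /= => /andP[t1 t2].
move=> /(@cis_arc R a D t D2)[]//.
- by rewrite (le_lt_trans _ t1) ?lerDl.
- by rewrite leNgt t1.
Qed.

Lemma dm_arc (a D : R) : 0 <= D <= 2 * pi -> dm (arc a (a + D)) = D%:E.
Proof.
move=> DD.
rewrite -[LHS]mul1e -(@integral_cst _ _ _ dm) /=; last exact: measurable_arc.
rewrite (@integral_arc a D (cst 1)) //; last exact: measurable_cst.
rewrite [LHS](@integral_cst _ _ _ lambda _ _ 1%:E) //= mul1e.
rewrite lebesgue_measure_itv/= lte_fin ltrDl.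
case: ltP => D0; first by rewrite -EFinB addrC addKr.
by congr EFin; apply/eqP; rewrite eq_le D0; case/andP: DD => ->.
Qed.

End circle_integral.

(** * Integrals of bounded functions *)

Section finite_measure_integral.
Context d (X : measurableType d) (R : realType).
Variables (m : {measure set X -> \bar R}) (A : set X).
Hypotheses (mA : measurable A) (finA : (m A < +oo)%E).

Lemma bounded_integrable (f : X -> R) (M : R) :
  measurable_fun setT f -> (forall x, `|f x| <= M) ->
  m.-integrable A (EFin \o f).
Proof.
move=> mf fM; apply: measurable_bounded_integrable => //.
  exact: measurable_funS mf.
exists M; split; first exact: num_real.
by move=> N MN x _; exact: le_trans (fM x) (ltW MN).
Qed.

Lemma integral_addcst (f : X -> R) (M c : R) :
  measurable_fun setT f -> (forall x, `|f x| <= M) ->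
  (\int[m]_(x in A) (f x + c)%:E = \int[m]_(x in A) (f x)%:E + c%:E * m A)%E.
Proof.
move=> mf fM.
under eq_integral do rewrite EFinD.
rewrite integralD //.
- by rewrite (@integral_cst _ _ _ m _ _ c%:E).
- exact: bounded_integrable fM.
- by apply: (@bounded_integrable (cst c) `|c|).
Qed.

(** The form in which integrals of |P|^2 are expanded. *)
Lemma integral_lincomb2 (n : nat) (r : nat -> R) (f : nat -> nat -> X -> R) (M : R) :
  (forall i j, measurable_fun setT (f i j)) ->
  (forall i j x, `|f i j x| <= M) ->
  (\int[m]_(x in A) (\sum_(i < n) \sum_(j < n) r i * r j * f i j x)%R%:E =
   \sum_(i < n) \sum_(j < n) (r i * r j)%:E * \int[m]_(x in A) (f i j x)%:E)%E.
Proof.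
move=> mf fM.
have intf i j : m.-integrable A (fun x => (r i * r j)%:E * (f i j x)%:E)%E.
  by apply: integrableZl => //; exact: (@bounded_integrable (f i j) M).
under eq_integral.
  move=> x _; rewrite -sumEFin.
  under eq_bigr do (rewrite -sumEFin; under eq_bigr do rewrite EFinM).
  over.
rewrite /= integral_sum //; last by move=> i; exact: integrable_sum.
apply: eq_bigr => i _; rewrite integral_sum //.
apply: eq_bigr => j _; rewrite integralZl //.
exact: (@bounded_integrable (f i j) M).
Qed.

End finite_measure_integral.

(** * The superlevel sets of a cosine over one period *)

Section cosine_bathtub.
Context {R : realType}.
Notation lambda := (@lebesgue_measure R).

Lemma measurable_cos_affine (m al : R) :
  measurable_fun setT (fun t : measurableTypeR R => cos (m * t + al) : measurableTypeR R).
Proof.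
apply: continuous_measurable_fun => t.
apply: continuous_comp; last exact: continuous_cos.
by apply: cvgD; [apply: cvgMr|exact: cvg_cst].
Qed.

(** The positive part of a cosine above the level c. *)
Definition excess (m al c t : R) : R := Num.max (cos (m * t + al) - c) 0.

Lemma excess_ge0 m al c t : 0 <= excess m al c t.
Proof. by rewrite le_max lexx orbT. Qed.

Lemma excess_le2 m al c t : -1 <= c -> excess m al c t <= 2.
Proof. by move=> c1; rewrite ge_max; have := cos_le1 (m * t + al); lra. Qed.

Lemma measurable_excess m al c :
  measurable_fun setT (fun t : measurableTypeR R => excess m al c t : measurableTypeR R).
Proof.
apply: measurable_maxr => //; apply: measurable_funB => //.
exact: measurable_cos_affine.
Qed.

(** The period is centred at a maximum - al / m of the cosine; there, as cos
    decreases on [0, pi], the values at least c = cos (m T / 2) are taken exactly on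
    the interval of half-length T / 2. *)
Lemma integral_excess_period (m al a T : R) :
  0 < m -> 0 < T -> m * T <= 2 * pi ->
  let c := cos (m * (T / 2)) in
  (\int[lambda]_(t in `]a, (a + 2 * pi / m)%R]) (excess m al c t)%:E =
   \int[lambda]_(t in `](- (T / 2))%R, (T / 2)%R]) (cos (m * t) - c)%R%:E)%E.
Proof.
move=> m0 T0 mT c; set L := 2 * pi / m.
have mL : m * L = 2 * pi by rewrite /L mulrC divfK // gt_eqF.
have L0 : 0 < L by rewrite divr_gt0 // mulr_gt0 // pi_gt0.
have TL : T <= L by rewrite ler_pdivlMr // mulrC.
have mpi u : 0 <= u <= L / 2 -> m * u \in `[0, pi].
  move=> /andP[u0 uL]; rewrite in_itv /= mulr_ge0 ?(ltW m0) //=.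
  by rewrite (le_trans (ler_wpM2l (ltW m0) uL)) // mulrA mL mulrC mulKf.
rewrite (@ge0_integral_period _ (excess m al c) _ _ (- (L / 2) + - (al / m)) L0).
- rewrite (_ : - (L / 2) + - (al / m) + L = L / 2 + - (al / m));
    last by field; rewrite gt_eqF.
  rewrite -(ge0_integral_shift _ _ _ (measurable_excess m al c)); last first.
    by move=> t; exact: excess_ge0.
  have shiftE t : excess m al c (t - al / m) = excess m 0 c t.
    by rewrite /excess mulrBr [m * (al / m)]mulrC divfK ?gt_eqF // subrK addr0.
  under eq_integral do rewrite shiftE.
  have E0 (t : R) : T / 2 <= `|t| -> `|t| <= L / 2 -> excess m 0 c t = 0.
    move=> tT tL; apply/max_idPr; rewrite addr0 subr_le0 /c.
    rewrite -[cos (m * t)]cos_norm normrM (gtr0_norm m0) leNgt ltr_cos -?leNgt.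
    + by rewrite ler_pM2l.
    + by apply: mpi; rewrite normr_ge0.
    + by apply: mpi; lra.
  have mex := measurable_excess m 0 c.
  rewrite (@ge0_integral_itvU _ (excess m 0 c) _ (- (T / 2))) //; last 3 first.
    by move=> t; exact: excess_ge0.
    by lra.
    by lra.
  rewrite (@ge0_integral_itvU _ (excess m 0 c) (- (T / 2)) (T / 2)) //; last 3 first.
    by move=> t; exact: excess_ge0.
    by lra.
    by lra.
  rewrite [X in (X + _)%E]integral0_eq; last first.
    move=> t; rewrite /= in_itv /= => /andP[t1 t2]; congr EFin.
    by apply: E0; rewrite ler0_norm; lra.
  rewrite [X in (_ + (_ + X))%E]integral0_eq; last first.
    move=> t; rewrite /= in_itv /= => /andP[t1 t2]; congr EFin.
    by apply: E0; rewrite ger0_norm; lra.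
  rewrite add0e adde0; apply: eq_integral => t.
  rewrite inE /= in_itv /= => /andP[t1 t2]; congr EFin.
  rewrite /excess addr0; apply/max_idPl; rewrite subr_ge0 /c.
  have tT : `|t| <= T / 2 by rewrite ler_norml; lra.
  rewrite -[cos (m * t)]cos_norm normrM (gtr0_norm m0) leNgt ltr_cos -?leNgt.
  + by rewrite ler_pM2l.
  + by apply: mpi; lra.
  + by apply: mpi; rewrite normr_ge0 /=; lra.
- exact: measurable_excess.
- by move=> t; exact: excess_ge0.
- move=> t; rewrite /excess; congr (Num.max (_ - _) _).
  by rewrite mulrDr mL addrAC; have := cos_intpi (m * t + al) 1; rewrite mulr1.
Qed.

End cosine_bathtub.

(** * Covering arcs *)

Section essential_diameter.
Context {R : realType}.
Variables (Omega : set (circle R)).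

Lemma arc_full (a : R) : arc a (a + 2 * pi) = setT.
Proof.
apply/seteqP; split => // z _.
have p0 : 0 < 2 * pi :> R by rewrite mulr_gt0 // pi_gt0.
have [k /andP[k0 k1]] := mod_period (arg z - a) p0.
exists (arg z - 2 * pi * k%:~R).
  by rewrite /= in_itv /=; apply/andP; split; lra.
by rewrite -mulrN -intrN cis_intpi argK.
Qed.

Lemma has_inf_arc_cover : has_inf [set D : R | 0 <= D <= 2 * pi /\
  exists a, dm.-negligible (Omega `\` arc a (a + D))].
Proof.
split; last by exists 0 => D [/andP[]].
exists (2 * pi); split; first by rewrite lexx mulr_ge0 // pi_ge0.
by exists 0; rewrite arc_full setDT; exact: negligible_set0.
Qed.

Hypothesis mOmega : measurable Omega.

(** For a nonnegative integrand, a null set can be dropped and Omega enlarged to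
    the arc that covers the rest of it. *)
Lemma integral_le_arc (a D : R) (F : circle R -> R) : 0 <= D <= 2 * pi ->
  dm.-negligible (Omega `\` arc a (a + D)) ->
  measurable_fun setT (F \o @cis R : measurableTypeR R -> R) ->
  (forall z, 0 <= F z) ->
  (\int[dm]_(z in Omega) (F z)%:E <=
   \int[@lebesgue_measure R]_(t in `]a, (a + D)%R]) (F (cis t))%:E)%E.
Proof.
move=> DD [N [mN N0 subN]] mFc F0; have mF := measurable_circle_fun mFc.
have mFE (B : set (circle R)) : measurable_fun B (fun z => (F z)%:E).
  by apply/measurable_EFinP; exact: measurable_funS mF.
rewrite -integral_arc // (@ge0_negligible_integral _ _ _ dm _ N) //; last first.
  by move=> z _; rewrite lee_fin.
apply: ge0_subset_integral => //.
- exact: measurableD.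
- exact: measurable_arc.
- by move=> z _; rewrite lee_fin.
- move=> z [Oz Nz]; apply: contrapT => az; apply: Nz; apply: subN.
  by split.
Qed.

Lemma dm_le_arc (a D : R) : 0 <= D <= 2 * pi ->
  dm.-negligible (Omega `\` arc a (a + D)) -> (dm Omega <= D%:E)%E.
Proof.
move=> DD negO.
have m1 : measurable_fun setT (cst 1 \o @cis R : measurableTypeR R -> R).
  exact: measurable_cst.
have := integral_le_arc DD negO m1 (fun=> ler01).
rewrite -(@integral_arc _ _ _ (cst 1)) // -(dm_arc a DD).
have dmE (A : set (circle R)) : measurable A ->
    (\int[dm]_(z in A) (cst 1 z)%:E = dm A)%E.
  by move=> mA; rewrite (@integral_cst _ _ _ dm _ _ 1%:E) ?mul1e.
by rewrite !dmE //; exact: measurable_arc.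
Qed.

End essential_diameter.

(** * Trigonometric monomials on the circle *)

Section wave.
Context {R : realType}.
Notation lambda := (@lebesgue_measure R).

(** The function e^{it} |-> cos (m t + al), well defined since m is an
    integer. *)
Definition wave (m : int) (al : R) (z : circle R) : R :=
  cos (m%:~R * arg z + al).

Lemma wave_cis (m : int) al t : wave m al (cis t) = cos (m%:~R * t + al).
Proof.
rewrite /wave; have [k ->] := arg_cis t.
rewrite -(cos_intpi (m%:~R * t + al) (m * k)) intrM; congr cos; ring.
Qed.

Lemma wave_le1 m al z : `|wave m al z| <= 1.
Proof. exact: cos_max. Qed.

Lemma wave_cis_comp (m : int) al :
  wave m al \o @cis R = fun t => cos (m%:~R * t + al).
Proof. by apply/funext => t; exact: wave_cis. Qed.

Lemma measurable_wave m al : measurable_fun setT (wave m al).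
Proof.
apply: measurable_circle_fun; rewrite wave_cis_comp.
exact: measurable_cos_affine.
Qed.

Lemma dm_fin (A : set (circle R)) : measurable A -> (dm A < +oo)%E.
Proof.
move=> mA; rewrite (@le_lt_trans _ _ (dm [set: circle R])) //.
  by apply: le_measure; rewrite ?inE.
by rewrite dmT ltry.
Qed.

Lemma measure_itvoc (x y : R) : x <= y -> lambda `]x, y] = (y - x)%:E.
Proof.
move=> xy; rewrite lebesgue_measure_itv /= lte_fin; case: ltP => // yx.
by congr EFin; apply/esym/eqP; rewrite subr_eq0 eq_le xy yx.
Qed.

Variables (Omega : set (circle R)) (mOmega : measurable Omega).
Variables (T : R) (T_gt0 : 0 < T) (dm_Omega : dm Omega = T%:E).
Let D := essential_arc_diameter Omega.

Lemma measure_le_essential_diameter : T <= D.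
Proof.
have [D0 _] := has_inf_arc_cover Omega.
apply: lb_le_inf => // D' [DD [a /(dm_le_arc mOmega DD)]].
by rewrite dm_Omega lee_fin.
Qed.

(** The bathtub inequality. Rather than an arc that attains the infimum D, the
    proof uses one of length D' < D + e / 2; whatever of it lies beyond a period
    2 pi / p >= D has length at most e / 2, and the integrand is at most 2. *)
Lemma integral_wave_pos_le (p : nat) (al : R) : (0 < p)%N ->
  p%:R * D <= 2 * pi ->
  (\int[dm]_(z in Omega) (wave p al z)%:E <=
   \int[lambda]_(t in `](- (T / 2))%R, (T / 2)%R]) (cos (p%:R * t))%:E)%E.
Proof.
move=> p0 pD; have TD := measure_le_essential_diameter.
have pp : 0 < p%:R :> R by rewrite ltr0n.
have pT : p%:R * T <= 2 * pi by rewrite (le_trans _ pD) // ler_pM2l.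
pose c : R := cos (p%:R * (T / 2)).
have TT : - (T / 2) <= T / 2 by have := T_gt0; lra.
have mT : lambda `]- (T / 2), T / 2] = T%:E.
  by rewrite measure_itvoc // opprK -splitr.
have finT : (lambda `](- (T / 2))%R, (T / 2)%R] < +oo)%E by rewrite mT ltry.
have finO := dm_fin mOmega.
have mcos : measurable_fun setT
    (fun t : measurableTypeR R => cos (p%:R * t) : measurableTypeR R).
  by under eq_fun do rewrite -[_ * _]addr0; exact: measurable_cos_affine.
(* The two domains have the same measure T, so the constant c cancels. *)
suff H : (\int[dm]_(z in Omega) (wave p al z - c)%:E <=
   \int[lambda]_(t in `](- (T / 2))%R, (T / 2)%R]) (cos (p%:R * t) - c)%:E)%E.
  move: H; rewrite (@integral_addcst _ _ _ dm _ mOmega finO _ 1 (- c)); last 2 first.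
  - exact: measurable_wave.
  - exact: wave_le1.
  rewrite (@integral_addcst _ _ _ lambda _ _ finT _ 1 (- c)) //; last first.
    by move=> t; exact: cos_max.
  rewrite [X in (_ + _ * X <= _)%E]dm_Omega [X in (_ <= _ + _ * X)%E]mT.
  by rewrite -EFinM leeD2rE.
apply/lee_addgt0Pr => e e0.
have e20 : 0 < e / 2 by rewrite divr_gt0.
(* Half of e, because the integrand is bounded by 2. *)
have [D' [DD [a negO]] D'D] := inf_adherent e20 (has_inf_arc_cover Omega).
pose F (z : circle R) : R := Num.max (wave p al z - c) 0.
have F0 z : 0 <= F z by rewrite le_max lexx orbT.
have Fc : F \o @cis R = excess p%:R al c.
  by apply/funext => t; rewrite /F /= wave_cis.
have mFc : measurable_fun setT (F \o @cis R : measurableTypeR R -> R).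
  by rewrite Fc; exact: measurable_excess.
have c1 : -1 <= c by exact: cos_geN1.
apply: (@le_trans _ _ (\int[dm]_(z in Omega) (F z)%:E)%E).
  apply: le_integral => //.
  - apply: (@bounded_integrable _ _ _ dm _ mOmega finO
      (fun z => wave p al z - c) 2).
      by apply: measurable_funB => //; exact: measurable_wave.
    move=> z; have := wave_le1 p al z; have := cos_max (p%:R * (T / 2)).
    by rewrite -/c !ler_norml => /andP[? ?] /andP[? ?]; apply/andP; split; lra.
  - apply: (@bounded_integrable _ _ _ dm _ mOmega finO F 2).
      exact: measurable_circle_fun.
    move=> z; rewrite ger0_norm // -[z]argK -[F _]/((F \o @cis R) _) Fc.
    exact: excess_le2.
  - by move=> z _; rewrite lee_fin le_max lexx.
apply: (le_trans (integral_le_arc mOmega DD negO mFc F0)).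
under eq_integral do rewrite -[F _]/((F \o @cis R) _) Fc.
rewrite -(integral_excess_period al a pp T_gt0 pT).
set L := 2 * pi / p%:R.
have L0 : 0 < L by rewrite divr_gt0 // mulr_gt0 // pi_gt0.
have DL : D <= L by rewrite ler_pdivlMr // mulrC.
have ex0 (t : R) : 0 <= excess p%:R al c t by exact: excess_ge0.
have mex := measurable_excess p%:R al c.
have [D'0 _] := andP DD.
have mexE (B : set R) : measurable_fun
    (B : set (measurableTypeR R)) (fun t => (excess p%:R al c t)%:E).
  by apply/measurable_EFinP; exact: measurable_funS mex.
apply: (@le_trans _ _
    (\int[lambda]_(t in `]a, (a + (L + e / 2))%R]) (excess p%:R al c t)%:E)%E).
  apply: ge0_subset_integral => //.
    by move=> t _; rewrite lee_fin.
  move=> t; rewrite /= !in_itv /= => /andP[-> /le_trans]; apply.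
  by rewrite lerD2l ltW // (lt_le_trans D'D) // lerD2r.
rewrite (@ge0_integral_itvU _ (excess p%:R al c) a (a + L)) //; last 2 first.
- by rewrite lerDl ltW.
- by rewrite addrA lerDl ltW.
rewrite leeD2l //.
apply: (@le_trans _ _
    (\int[lambda]_(t in `](a + L)%R, (a + (L + e / 2))%R]) (cst 2%:E t))%E).
  apply: ge0_le_integral => //.
  - by move=> t _; rewrite lee_fin.
  - by move=> t _; rewrite lee_fin excess_le2.
rewrite (@integral_cst _ _ _ lambda) // [X in (_ * X)%E]measure_itvoc; last first.
  by rewrite addrA lerDl ltW.
by rewrite -EFinM lee_fin; lra.
Qed.

Lemma integral_wave_le (m : int) (al : R) :
  `|m|%:~R * D <= 2 * pi ->
  (\int[dm]_(z in Omega) (wave m al z)%:E <=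
   \int[lambda]_(t in `](- (T / 2))%R, (T / 2)%R]) (cos (m%:~R * t))%:E)%E.
Proof.
case: m => [[|p]|p] mD.
- under [leRHS]eq_integral do rewrite mul0r cos0.
  rewrite (@integral_cst _ _ _ lambda _ _ 1%:E) // mul1e [leRHS]measure_itvoc;
    last by have := T_gt0; lra.
  rewrite opprK -splitr -dm_Omega -[leRHS]mul1e -(@integral_cst _ _ _ dm _ _ 1%:E) //.
  apply: le_integral => //.
  + apply: (@bounded_integrable _ _ _ dm _ mOmega (dm_fin mOmega) _ 1).
      exact: measurable_wave.
    exact: wave_le1.
  + apply: (@bounded_integrable _ _ _ dm _ mOmega (dm_fin mOmega) (cst 1) 1) => //.
    by move=> z; rewrite normr1.
  + by move=> z _; rewrite lee_fin; exact: cos_le1.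
- exact: integral_wave_pos_le.
- rewrite NegzE.
  have wE z : wave (- p.+1%:Z) al z = wave p.+1 (- al) z.
    by rewrite /wave -cosN intrN mulNr opprD opprK.
  under eq_integral do rewrite wE.
  under [leRHS]eq_integral do rewrite intrN mulNr cosN.
  exact: integral_wave_pos_le.
Qed.

(** The phase is a translation by al / m, to which an integral over a full
    period is insensitive. Adding 1 makes the integrand nonnegative. *)
Lemma integral_wave_full (m : int) (al : R) : m != 0 ->
  (\int[dm]_(z in setT) (wave m al z)%:E = \int[dm]_(z in setT) (wave m 0 z)%:E)%E.
Proof.
move=> m0; have mT := @dm_fin setT measurableT.
have mr : m%:~R != 0 :> R by rewrite intr_eq0.
have p0 : 0 < 2 * pi :> R by rewrite mulr_gt0 // pi_gt0.
suff : (\int[dm]_(z in setT) (wave m al z + 1)%:E =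
    \int[dm]_(z in setT) (wave m 0 z + 1)%:E)%E.
  rewrite !(@integral_addcst _ _ _ dm _ measurableT mT _ 1); last 4 first.
  - exact: measurable_wave.
  - exact: wave_le1.
  - exact: measurable_wave.
  - exact: wave_le1.
  move/(congr1 (fun x => x - 1%:E * dm [set: circle R])%E).
  by rewrite !addeK //; apply: fin_numM => //; rewrite ge0_fin_numE.
have w0 be z : 0 <= wave m be z + 1.
  by rewrite -lerBlDr sub0r; exact: cos_geN1.
have mcos be : measurable_fun setT
    (fun t : measurableTypeR R => cos (m%:~R * t + be) + 1 : measurableTypeR R).
  by apply: measurable_funD => //; exact: measurable_cos_affine.
have cos0 be t : 0 <= cos (m%:~R * t + be) + 1 :> R.
  by rewrite -lerBlDr sub0r; exact: cos_geN1.
have lineE be : (\int[dm]_(z in setT) (wave m be z + 1)%:E =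
    \int[lambda]_(t in `]0%R, (0 + 2 * pi)%R]) (cos (m%:~R * t + be) + 1)%:E)%E.
  rewrite -(arc_full 0) (@integral_arc _ _ _ (fun z => wave m be z + 1)) //.
  - by apply: eq_integral => t _; rewrite wave_cis.
  - by rewrite lexx ltW.
  - have -> : (fun z => wave m be z + 1) \o @cis R = fun t => cos (m%:~R * t + be) + 1.
      by apply/funext => t /=; rewrite wave_cis.
    exact: mcos.
rewrite !lineE.
have shiftE t : cos (m%:~R * t + al) + 1 = cos (m%:~R * (t + al / m%:~R) + 0) + 1.
  by congr (cos _ + 1); field.
under eq_integral do rewrite shiftE.
rewrite (ge0_integral_shift (al / m%:~R) 0 (0 + 2 * pi) (mcos 0) (cos0 0)) addrAC.
apply: (ge0_integral_period _ _ p0 (mcos 0) (cos0 0)) => t; congr (_ + 1).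
rewrite -(cos_intpi (m%:~R * t + 0) m); congr cos; ring.
Qed.

End wave.

(** * The square of the modulus of a polynomial *)

Section modulus.
Context {R : realType}.
Notation lambda := (@lebesgue_measure R).

Lemma cis_exp (t : R) (k : nat) :
  (cos t +i* sin t) ^+ k = cos (k%:R * t) +i* sin (k%:R * t).
Proof.
elim: k => [|k IHk]; first by rewrite expr0 mul0r cos0 sin0.
rewrite exprS IHk -natr1 mulrDl mul1r addrC cosD sinD.
by apply/eqP; rewrite eq_complex /=; apply/andP; split; apply/eqP; ring.
Qed.

Lemma sum_complex (n : nat) (x y : nat -> R) :
  \sum_(i < n) (x i +i* y i) = (\sum_(i < n) x i) +i* (\sum_(i < n) y i).
Proof.
elim: n => [|n IHn]; first by rewrite !big_ord0.
by rewrite !big_ord_recr /= IHn.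
Qed.

(** With u_k = k t + b_k the modulus squared is
    (\sum r_k cos u_k)^2 + (\sum r_k sin u_k)^2, and
    cos u_i cos u_j + sin u_i sin u_j = cos (u_i - u_j). *)
Lemma modulus_sqrE (n : nat) (P : {poly R[i]}) (r b : nat -> R) (z : circle R) :
  (size P <= n)%N ->
  (forall k, P`_k = (r k * cos (b k)) +i* (r k * sin (b k))) ->
  modulus P z ^+ 2 =
    \sum_(i < n) \sum_(j < n) r i * r j * wave (i%:Z - j%:Z) (b i - b j) z.
Proof.
move=> sP Pk; rewrite /modulus (horner_coef_wide _ sP) -[z]argK; set t := arg z.
pose u k := k%:R * t + b k.
have -> : \sum_(i < n) P`_i * val (cis t) ^+ i =
    (\sum_(i < n) r i * cos (u i)) +i* (\sum_(i < n) r i * sin (u i)).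
  rewrite -(sum_complex n (fun i => r i * cos (u i)) (fun i => r i * sin (u i))).
  apply: eq_bigr => i _; rewrite Pk cis_exp /u addrC cosD sinD.
  by apply/eqP; rewrite eq_complex /=; apply/andP; split; apply/eqP; ring.
rewrite /= sqr_sqrtr ?addr_ge0 ?sqr_ge0 // !expr2 !big_distrlr /= -big_split /=.
apply: eq_bigr => i _; rewrite -big_split /=; apply: eq_bigr => j _.
rewrite wave_cis (_ : _ * t + _ = u i - u j); last first.
  by rewrite /u intrB; ring.
by rewrite cosB; ring.
Qed.

Lemma modulus_sqr_cis (n : nat) (P : {poly R[i]}) (r : nat -> R) (t : R) :
  (size P <= n)%N -> (forall k, P`_k = (r k)%:C) ->
  modulus P (cis t) ^+ 2 =
    \sum_(i < n) \sum_(j < n) r i * r j * cos ((i%:Z - j%:Z)%:~R * t).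
Proof.
move=> sP Pk; rewrite (@modulus_sqrE n P r (fun=> 0)) //.
  by apply: eq_bigr => i _; apply: eq_bigr => j _; rewrite wave_cis subrr addr0.
by move=> k; rewrite cos0 sin0 mulr1 mulr0 Pk.
Qed.

Lemma L2norm_sqrE (P : {poly R[i]}) :
  L2norm P = ((\int[dm]_(z in setT) (modulus P z ^+ 2)%:E) `^ 2^-1)%E.
Proof.
rewrite /L2norm unlock; congr (_ `^ _)%E; apply: eq_integral => z _ /=.
by rewrite powR_mulrn // real_normK ?num_real.
Qed.

End modulus.

Theorem theorem6p4 (R : realType) (Omega : set (circle R))
    (mOmega : measurable Omega)
    (T : R) (T_gt0 : 0 < T) (dm_Omega : dm Omega = T%:E)
    (n : nat) (n_ge1 : (1 <= n)%N)
    (P : {poly R[i]}) (degP : size P = n.+1)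
    (nD : n%:R * essential_arc_diameter Omega <= 2 * pi) :
  let Q := \poly_(k < n.+1) `|P`_k| in
  [/\ (\int[dm]_(z in Omega) (modulus P z ^+ 2)%:E
         <= \int[dm]_(z in centered_arc T) (modulus Q z ^+ 2)%:E)%E,
      L2norm P = L2norm Q
    & concentration Omega P <= concentration (centered_arc T) Q].
Proof.
move=> Q.
pose r k := normc P`_k.
pose b k := sval (cid (polarP P`_k)).
have r0 k : 0 <= r k by rewrite /r; case: P`_k => x y; exact: sqrtr_ge0.
have Pk k : P`_k = (r k * cos (b k)) +i* (r k * sin (b k)).
  by rewrite /b; case: cid.
have Qk k : Q`_k = (r k)%:C.
  rewrite coef_poly; case: ltnP => kn; first by rewrite /r normc_def; case: P`_k.
  by rewrite /r nth_default ?degP //= expr0n /= addr0 sqrtr0.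
have sP : (size P <= n.+1)%N by rewrite degP.
have sQ : (size Q <= n.+1)%N by exact: size_poly.
have modP z := modulus_sqrE z sP Pk.
have modQ z : modulus Q z ^+ 2 = \sum_(i < n.+1) \sum_(j < n.+1)
    r i * r j * wave (i%:Z - j%:Z) 0 z.
  rewrite (@modulus_sqrE _ n.+1 Q r (fun=> 0)) ?subrr //.
  by move=> k; rewrite cos0 sin0 mulr1 mulr0 Qk.
have mwP i j := @measurable_wave R (i%:Z - j%:Z) (b i - b j).
have mwQ i j := @measurable_wave R (i%:Z - j%:Z) 0.
have wP1 i j := @wave_le1 R (i%:Z - j%:Z) (b i - b j).
have wQ1 i j := @wave_le1 R (i%:Z - j%:Z) 0.
have TD : T <= essential_arc_diameter Omega.
  exact: measure_le_essential_diameter.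
have T2pi : T <= 2 * pi.
  rewrite -lee_fin -dm_Omega -dmT; apply: le_measure; rewrite ?inE //.
have TT : - (T / 2) <= T / 2 by lra.
have centeredE : centered_arc T = arc (- (T / 2)) (- (T / 2) + T).
  by rewrite /centered_arc; congr Defs.arc; lra.
have mcT : measurable (centered_arc T : set (circle R)).
  by rewrite centeredE; exact: measurable_arc.
have intP A : measurable A ->
    (\int[dm]_(z in A) (modulus P z ^+ 2)%:E = \sum_(i < n.+1) \sum_(j < n.+1)
      (r i * r j)%:E * \int[dm]_(z in A) (wave (i%:Z - j%:Z) (b i - b j) z)%:E)%E.
  move=> mA; under eq_integral do rewrite modP.
  by rewrite (@integral_lincomb2 _ _ _ dm _ mA (dm_fin mA) _ _
    (fun i j => wave (i%:Z - j%:Z) (b i - b j)) 1).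
have intQ A : measurable A ->
    (\int[dm]_(z in A) (modulus Q z ^+ 2)%:E = \sum_(i < n.+1) \sum_(j < n.+1)
      (r i * r j)%:E * \int[dm]_(z in A) (wave (i%:Z - j%:Z) 0 z)%:E)%E.
  move=> mA; under eq_integral do rewrite modQ.
  by rewrite (@integral_lincomb2 _ _ _ dm _ mA (dm_fin mA) _ _
    (fun i j => wave (i%:Z - j%:Z) 0) 1).
have mP2 : measurable_fun setT (fun z => modulus P z ^+ 2).
  under eq_fun do rewrite modP.
  by do 2 (apply: measurable_sum => ?); apply: measurable_funM.
have mQ2 : measurable_fun setT (fun z => modulus Q z ^+ 2).
  under eq_fun do rewrite modQ.
  by do 2 (apply: measurable_sum => ?); apply: measurable_funM.
have finE (F : circle R -> R) A : measurable A ->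
    measurable_fun setT F -> (exists M, forall z, `|F z| <= M) ->
    (\int[dm]_(z in A) (F z)%:E)%E \is a fin_num.
  move=> mA mF [M FM]; apply: integrable_fin_num => //.
  exact: (@bounded_integrable _ _ _ dm _ mA (dm_fin mA) F M).
have bnd (w : nat -> nat -> R) : (forall i j, `|w i j| <= 1) ->
    `|\sum_(i < n.+1) \sum_(j < n.+1) r i * r j * w i j| <=
      \sum_(i < n.+1) \sum_(j < n.+1) r i * r j.
  move=> w1; apply: (le_trans (ler_norm_sum _ _ _)); apply: ler_sum => i _.
  apply: (le_trans (ler_norm_sum _ _ _)); apply: ler_sum => j _.
  rewrite normrM (ger0_norm (mulr_ge0 (r0 i) (r0 j))).
  by rewrite -[leRHS]mulr1 ler_wpM2l // mulr_ge0.
(* A concentration is a quotient of the real values of extended integrals; comparing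
   these requires the integrals to be finite. *)
have finP A : measurable A -> (\int[dm]_(z in A) (modulus P z ^+ 2)%:E)%E \is a fin_num.
  move=> mA; apply: finE => //; eexists => z; rewrite modP.
  exact: (bnd (fun i j => wave (i%:Z - j%:Z) (b i - b j) z)).
have finQ A : measurable A -> (\int[dm]_(z in A) (modulus Q z ^+ 2)%:E)%E \is a fin_num.
  move=> mA; apply: finE => //; eexists => z; rewrite modQ.
  exact: (bnd (fun i j => wave (i%:Z - j%:Z) 0 z)).
have localE : (\int[dm]_(z in Omega) (modulus P z ^+ 2)%:E
         <= \int[dm]_(z in centered_arc T) (modulus Q z ^+ 2)%:E)%E.
  have finT : (@lebesgue_measure R `](- (T / 2))%R, (T / 2)%R] < +oo)%E.
    by rewrite measure_itvoc // ltry.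
  have mcos (m : int) : measurable_fun setT
      (fun t : measurableTypeR R => cos (m%:~R * t) : measurableTypeR R).
    by under eq_fun do rewrite -[_ * _]addr0; exact: measurable_cos_affine.
  rewrite intP // centeredE (@integral_arc _ _ _ (fun z => modulus Q z ^+ 2)); last 3 first.
  - by rewrite ltW.
  - rewrite (_ : _ \o _ = fun t => \sum_(i < n.+1) \sum_(j < n.+1)
      r i * r j * cos ((i%:Z - j%:Z)%:~R * t)); last first.
      by apply/funext => t; exact: modulus_sqr_cis.
    by do 2 (apply: measurable_sum => ?); apply: measurable_funM => //; exact: mcos.
  - by move=> z; rewrite sqr_ge0.
  under [leRHS]eq_integral do rewrite (modulus_sqr_cis _ sQ Qk).
  rewrite (_ : - (T / 2) + T = T / 2); last by lra.
  rewrite (@integral_lincomb2 _ _ _ (@lebesgue_measure R) _ _ finT _ _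
    (fun i j t => cos ((i%:Z - j%:Z)%:~R * t)) 1) //; last 2 first.
  - by move=> i j; exact: mcos.
  - by move=> i j t; exact: cos_max.
  (* Both sides are now double sums with the same coefficients r_i r_j >= 0. *)
  apply: lee_sum => i _; apply: lee_sum => j _.
  apply: lee_wpmul2l; first by rewrite lee_fin mulr_ge0.
  apply: integral_wave_le => //; apply: le_trans nD.
  rewrite ler_wpM2r ?(le_trans (ltW T_gt0)) // (ler_int _ _ n).
  by have := ltn_ord i; have := ltn_ord j; lia.
have totalE : (\int[dm]_(z in setT) (modulus P z ^+ 2)%:E =
               \int[dm]_(z in setT) (modulus Q z ^+ 2)%:E)%E.
  rewrite intP // intQ //; apply: eq_bigr => i _; apply: eq_bigr => j _.
  (* On the diagonal the phase b_i - b_i vanishes. *)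
  congr (_ * _)%E; have [/eqP|] := eqVneq (i%:Z - j%:Z) 0;
    last exact: integral_wave_full.
  by rewrite subr_eq0 => /eqP [->]; rewrite !subrr.
split => //; first by rewrite !L2norm_sqrE totalE.
rewrite /concentration /Rintegral totalE ler_wpM2r //.
  by rewrite invr_ge0 fine_ge0 // integral_ge0 // => z _; rewrite lee_fin sqr_ge0.
by apply: fine_le; rewrite ?finP ?finQ.
Qed.
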